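(* Let $S$ be any one of the following five sets of positive integers: (i) the Hardy--Ramanujan numbers; (ii) the Jordan--P\'olya numbers; (iii) the positive fibbinary numbers; (iv) the set of all positive integers that are either a sum of distinct powers of four or twice a sum of distinct powers of four; (v) the set of all positive integers of the form $2^k\ell$ with $k\ge 0$ an integer, $\ell$ an odd positive integer, and $2^k\ge \ell$. Then every rational number $q$ with $0<q<\sum_{s\in S}\frac{1}{s}$ has an Egyptian fraction representation in which all denominators belong to $S$; that is, there is a finite subset $D\subseteq S$ with $q=\sum_{d\in D}\frac{1}{d}$.
   Context: An \emph{Egyptian fraction} is a representation of a rational number as a finite sum of distinct unit fractions $1/d$ with $d$ a positive integer; the unit fraction $1/1$ is allowed. The \emph{Hardy--Ramanujan numbers} (OEIS A025487) are the positive integers whose prime factorization $2^{e_2}3^{e_3}5^{e_5}\cdots$ (over all primes in increasing order, exponents being nonnegative integers, all but finitely many zero) satisfies $e_2\ge e_3\ge e_5\ge\cdots$; in particular $1$ is included. The \emph{Jordan--P\'olya numbers} (OEIS A001013) are the positive integers that are products of factorials of positive integers (repetition allowed; $1$ is included). The \emph{fibbinary numbers} (OEIS A003714) are the nonnegative integers whose binary representation has no two consecutive nonzero bits. Powers of four are the numbers $4^i$ with $i\ge 0$ an integer; the set in (iv) is OEIS A126684 and the set in (v) is OEIS A116882. *)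

(* Defs.v *)
(* MathComp / MathComp-Analysis *)
From mathcomp Require Import all_boot finmap classical_sets.

Set Implicit Arguments.
Unset Strict Implicit.
Unset Printing Implicit Defensive.

Local Open Scope nat_scope.
Local Open Scope classical_set_scope.

(* [logn p n] is the exponent of the prime [p] in [n]; since [logn p 0 = 0],
   positivity has to be required separately. *)
Definition hardy_ramanujan : set nat :=
  [set n | 0 < n /\
    forall p q : nat, prime p -> prime q -> p <= q -> logn q n <= logn p n].

Definition jordan_polya : set nat :=
  [set n | exists s : seq nat,
    (forall k : nat, k \in s -> 0 < k) /\ n = \prod_(k <- s) k`!].

(* [Nat.testbit n i] is the coefficient of 2 ^ i in the binary expansion. *)
Definition fibbinary : set nat :=
  [set n | forall i : nat, ~~ (Nat.testbit n i && Nat.testbit n i.+1)].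

Definition positive_fibbinary : set nat := [set n | 0 < n /\ fibbinary n].

(* The finite set [A] is the set of exponents, hence the powers are distinct. *)
Definition sum_distinct_pow4 : set nat :=
  [set n | exists A : {fset nat}, n = \sum_(i <- A) 4 ^ i].

Definition pow4_sum_or_double : set nat :=
  [set n | 0 < n /\
    (sum_distinct_pow4 n \/ exists m, sum_distinct_pow4 m /\ n = 2 * m)].

Definition two_part_dominant : set nat :=
  [set n | exists k l : nat, [/\ odd l, l <= 2 ^ k & n = 2 ^ k * l]].

(* Main.v *)
(* Let S be a set of positive integers that is closed under doubling and
   contains a multiple of every positive integer.  Given q below the sum of the
   reciprocals of a finite F included in S, pick s in S divisible by the
   denominator of q and by F, and put M := 2 ^ s * s.  The integers a dividing M
   with M / a in S contain 1, 2, ..., 2 ^ s; if a is even then a / 2 is one of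
   them, and if a is odd then a <= s <= 2 ^ s.  Hence each a is at most one more
   than the sum of the smaller ones, so that every integer up to their total,
   in particular q * M, is a sum of distinct a's; dividing by M gives q. *)
Require Import Defs.
From mathcomp Require Import all_boot all_order all_algebra finmap.
From mathcomp Require Import cyclic ring.
From mathcomp Require Import boolp classical_sets cardinality fsbigop.
From mathcomp Require Import reals ereal esum.

Set Implicit Arguments.
Unset Strict Implicit.
Unset Printing Implicit Defensive.

Import Order.TTheory GRing.Theory Num.Theory.

Local Open Scope nat_scope.

(** * Subset sums of complete sequences of naturals *)

(** Greedy choice from the top: if [n] exceeds the total of the terms below [m], then [m] is a term
    and is taken. Completeness at [m] gives [m <= n], and the remainder [n - m] is within reach of
    the smaller terms. *)
Lemma subset_sum_complete (P : pred nat) (m n : nat) :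
  (forall a, a < m -> P a -> a <= (\sum_(0 <= x < a | P x) x).+1) ->
  n <= \sum_(0 <= x < m | P x) x ->
  exists s : seq nat,
    [/\ uniq s, {in s, forall x, x < m /\ P x} & n = \sum_(x <- s) x].
Proof.
elim: m n => [|m IHm] n Pcomplete.
  by rewrite big_geq // leqn0 => /eqP ->; exists [::]; rewrite big_nil.
have {}IHm k : k <= \sum_(0 <= x < m | P x) x -> exists s : seq nat,
    [/\ uniq s, {in s, forall x, x < m /\ P x} & k = \sum_(x <- s) x].
  by apply: IHm => a am; apply: Pcomplete; apply: ltnW.
rewrite big_mkcond big_nat_recr //= -big_mkcond /= => n_le.
have [/IHm|n_gt] := leqP n (\sum_(0 <= x < m | P x) x).
  case=> s [us Ps n_eq]; exists s; split=> // x /Ps[xm Px].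
  by split=> //; apply: ltnW.
have Pm : P m by case: ifPn n_le => //; rewrite addn0 leqNgt n_gt.
rewrite Pm in n_le.
have m_le_n : m <= n := leq_trans (Pcomplete m (leqnn _) Pm) n_gt.
have [|s [us Ps n_eq]] := IHm (n - m); first by rewrite leq_subLR addnC.
exists (m :: s); split=> [|x|].
- by rewrite /= us andbT; apply/negP => /Ps[]; rewrite ltnn.
- by rewrite inE => /predU1P[->//|/Ps[xm Px]]; split=> //; apply: ltnW.
- by rewrite big_cons -n_eq subnKC.
Qed.

Lemma divn_codivisor_inj M : 0 < M -> {in [pred d | d %| M] &, injective (divn M)}.
Proof.
move=> M_gt0 d e; rewrite !inE => dM eM de.
by rewrite -(mulKn d M_gt0) -(mulKn e M_gt0) -!divnA // de.
Qed.

(** Let [2 ^ j] be the largest power of two below [t]. By induction the terms below it total at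
    least [2 ^ j - 1], and adding [2 ^ j] itself gives [2 ^ j.+1 - 1], which is at least [t - 1]. *)
Lemma pow2_complete (P : pred nat) k t :
  (forall j, j <= k -> P (2 ^ j)) -> t <= 2 ^ k ->
  t <= (\sum_(0 <= x < t | P x) x).+1.
Proof.
move=> Ppow; elim/ltn_ind: t => -[|[|t]] // IHt t_le.
have /andP[] := trunc_log_bounds (isT : 1 < 2) (ltn0Sn t).
set j := trunc_log 2 t.+1; rewrite -ltnS => j_le t_lt.
have jk : j <= k by rewrite -(@leq_exp2l 2) // ltnW // (leq_trans j_le).
rewrite (big_cat_nat _ (n := 2 ^ j)) ?(ltnW j_le) //=.
rewrite [X in _ + X]big_mkcond big_ltn //= Ppow //.
apply: leq_trans t_lt _; rewrite expnS mul2n -addnn -addSn addnA.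
apply: leq_trans (leq_addr _ _); rewrite leq_add2r.
by apply: IHt => //; apply: ltnW; apply: leq_trans t_le.
Qed.

(** * Egyptian fractions over a set closed under doubling *)

Section ClosedUnderDoubling.

Variable S : set nat.
Hypothesis S_gt0 : forall n, S n -> 0 < n.
Hypothesis S_double : forall n, S n -> S (2 * n).

Lemma S_exp2M k n : S n -> S (2 ^ k * n).
Proof.
by move=> Sn; elim: k => [|k IHk]; rewrite ?mul1n // expnS -mulnA; apply: S_double.
Qed.

Lemma multiple_of_odd_multiple :
  (forall l, odd l -> exists2 s, S s & l %| s) ->
  forall n, 0 < n -> exists2 s, S s & n %| s.
Proof.
move=> S_odd n n_gt0.
have [l l_odd ->] := pfactor_coprime (isT : prime 2) n_gt0.
rewrite coprime2n in l_odd.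
have [s Ss ls] := S_odd _ l_odd.
by exists (2 ^ logn 2 n * s); [apply: S_exp2M|rewrite mulnC dvdn_mul].
Qed.

(** These are the numerators [a] for which [a / M] reduces to a unit fraction with denominator
    [M %/ a] in [S]. *)
Definition codivisor M a := (a %| M) && `[< S (M %/ a) >].

Lemma codivisor_complete s a : S s -> codivisor (2 ^ s * s) a ->
  a <= (\sum_(0 <= x < a | codivisor (2 ^ s * s) x) x).+1.
Proof.
set M := 2 ^ s * s => Ss.
have M_gt0 : 0 < M by rewrite muln_gt0 expn_gt0 /= S_gt0.
have pow2_codivisor j : j <= s -> codivisor M (2 ^ j).
  move=> js; have M_eq : M = 2 ^ (s - j) * s * 2 ^ j.
    by rewrite /M -{1}(subnK js) expnD mulnAC.
  rewrite /codivisor M_eq dvdn_mull //= mulnK ?expn_gt0 //.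
  by apply/asboolP; apply: S_exp2M.
elim/ltn_ind: a => a IHa /andP[aM /asboolP Sa].
have a_gt0 : 0 < a := dvdn_gt0 M_gt0 aM.
have [a_odd|a_even] := boolP (odd a).
  (* An odd [a] is coprime to [2 ^ s], so it divides [s], and [s < 2 ^ s] keeps it within the range
     of the powers of two. *)
  apply: (@pow2_complete _ s) => //.
  have: a %| s by rewrite -(@Gauss_dvdr _ (2 ^ s)) // coprimeXr // coprimen2.
  move/dvdn_leq => /(_ (S_gt0 Ss)) /leq_trans; apply.
  exact: ltnW (ltn_expl _ _).
set b := a./2.
have a_eq : a = b + b by rewrite addnn even_halfK.
have b_gt0 : 0 < b by rewrite -double_gt0 -addnn -a_eq.
have b_lt : b < a by rewrite a_eq -[X in X < _]addn0 ltn_add2l.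
(* Halving [a] doubles the quotient: [M %/ b] is [2 * (M %/ a)]. *)
have bM : codivisor M b.
  have [c M_eq] := dvdnP aM.
  rewrite M_eq mulnK // in Sa.
  rewrite /codivisor {1 2}M_eq a_eq addnn -mul2n mulnA dvdn_mull //= mulnK //.
  by apply/asboolP; rewrite mulnC; apply: S_double.
(* The terms below [b] total at least [b - 1] by induction, and [b] is itself a term below
   [a = b + b]. *)
rewrite (big_cat_nat _ (n := b)) ?(ltnW b_lt) //=.
rewrite [X in _ + X]big_mkcond big_ltn //= bM {1}a_eq -addSn addnA.
by apply: leq_trans (leq_addr _ _); rewrite leq_add2r; apply: IHa.
Qed.

(** Each [a / M] is the reciprocal of [M %/ a], and distinct divisors of [M] have distinct
    quotients. *)
Lemma egyptian_of_codivisor_sum M (s : seq nat) : 0 < M ->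
  uniq s -> {in s, forall a, codivisor M a} ->
  exists D : {fset nat}, (forall d, d \in D -> S d) /\
    ((\sum_(x <- s) x)%:R / M%:R = \sum_(d <- D) d%:R^-1 :> rat)%R.
Proof.
move=> M_gt0 us sM.
pose l := [seq M %/ a | a <- s].
exists [fset d in l]%fset; split=> [d|].
  by rewrite inE => /mapP[a /sM/andP[_ /asboolP Sa] ->].
have -> : (\sum_(d <- [fset d in l]%fset) d%:R^-1 =
           \sum_(d <- l) d%:R^-1 :> rat)%R.
  apply: perm_big; apply: uniq_perm => [||d]; [exact: fset_uniq| |by rewrite inE].
  rewrite map_inj_in_uniq // => a b sa sb; apply: divn_codivisor_inj => //.
    by have /andP[] := sM _ sa.
  by have /andP[] := sM _ sb.
rewrite /l big_map natr_sum mulr_suml; apply: eq_big_seq => a sa.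
have /andP[/dvdnP[c M_eq] _] := sM _ sa.
have a_gt0 : 0 < a by apply: dvdn_gt0 M_gt0 _; rewrite M_eq dvdn_mull.
by rewrite M_eq mulnK // natrM invfM mulrCA divff ?mulr1 // pnatr_eq0 -lt0n.
Qed.

Lemma egyptian_of_doubling (F : {fset nat}) (q : rat) :
  (forall n, 0 < n -> exists2 s, S s & n %| s) ->
  (forall f, f \in F -> S f) ->
  (0 < q)%R -> (q <= \sum_(f <- F) f%:R^-1)%R ->
  exists D : {fset nat}, (forall d, d \in D -> S d) /\
    (q = \sum_(d <- D) d%:R^-1)%R.
Proof.
move=> S_dvd FS q_gt0 q_le.
have F_gt0 : 0 < \prod_(f <- F) f.
  by rewrite big_seq prodn_cond_gt0 // => f /FS/S_gt0.
have den_gt0 : 0 < `|denq q| by rewrite absz_gt0 denq_neq0.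
have [|s Ss sN] := S_dvd (`|denq q| * \prod_(f <- F) f).
  by rewrite muln_gt0 den_gt0.
have Fs f : f \in F -> f %| s.
  move=> fF; apply: dvdn_trans sN; apply: dvdn_mull.
  by rewrite (big_fsetD1 f fF) dvdn_mulr.
have {sN} /dvdnP[c s_eq] : `|denq q| %| s by apply: dvdn_trans sN; apply: dvdn_mulr.
set M := 2 ^ s * s.
have M_gt0 : 0 < M by rewrite muln_gt0 expn_gt0 /= S_gt0.
have [n q_eq] : exists n, q = (n%:R / M%:R)%R.
  (* Since [s] is [c] times the denominator of [q], the factor [2 ^ s * c] is [M] over that
     denominator. *)
  exists (`|numq q| * (2 ^ s * c)).
  have num_eq : (`|numq q|%:R = (numq q)%:~R :> rat)%R.
    by rewrite natr_absz gtr0_norm ?numq_gt0.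
  have den_eq : (`|denq q|%:R = (denq q)%:~R :> rat)%R.
    by rewrite natr_absz gtr0_norm ?denq_gt0.
  have s_neq0 : (s%:R : rat) != 0%R by rewrite pnatr_eq0 -lt0n S_gt0.
  rewrite s_eq natrM den_eq mulf_eq0 negb_or in s_neq0.
  case/andP: s_neq0 => c_neq0 den_neq0.
  rewrite -{1}(divq_num_den q) /M {3}s_eq !natrM num_eq den_eq.
  have exp_neq0 : ((2 ^ s)%:R : rat) != 0%R by rewrite pnatr_eq0 -lt0n expn_gt0.
  by field; rewrite den_neq0 c_neq0 exp_neq0.
have FM f : f \in F -> codivisor M (M %/ f).
  move=> fF; have fM : f %| M by rewrite dvdn_mull // Fs.
  apply/andP; split; first by apply/dvdnP; exists f; rewrite mulnC divnK.
  by rewrite divnA // mulKn //; apply/asboolP/FS.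
(* The numbers [M %/ f] are distinct codivisors whose sum is at least [q * M]. The range ends at
   [M.+1] because [M] itself may be a codivisor. *)
have n_le : n <= \sum_(0 <= x < M.+1 | codivisor M x) x.
  have n_le : n <= \sum_(f <- F) M %/ f.
    rewrite -(ler_nat rat) natr_sum -(@ler_pM2r _ M%:R^-1) ?invr_gt0 ?ltr0n //.
    rewrite -q_eq (le_trans q_le) // mulr_suml big_seq [leRHS]big_seq.
    apply: ler_sum => f fF.
    have f_neq0 : (f%:R : rat) != 0%R by rewrite pnatr_eq0 -lt0n; apply/S_gt0/FS.
    have M_neq0 : (M%:R : rat) != 0%R by rewrite pnatr_eq0 -lt0n.
    have fM : f %| M by rewrite dvdn_mull // Fs.
    suff -> : ((M %/ f)%:R = M%:R / f%:R :> rat)%R by rewrite mulrAC divff ?mul1r.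
    by apply: (canRL (mulfK f_neq0)); rewrite -natrM divnK.
  apply: leq_trans n_le _.
  rewrite -(big_map (divn M) xpredT id) -[leqRHS]big_filter.
  apply: (uniq_sub_le_big leqnn (fun x y => leq_addr y x));
    rewrite ?filter_uniq ?iota_uniq //.
    rewrite map_inj_in_uniq ?fset_uniq // => f g fF gF.
    by apply: divn_codivisor_inj; rewrite // inE dvdn_mull // Fs.
  move=> a /mapP[f fF ->].
  by rewrite mem_filter FM // mem_index_iota ltnS leq_div.
have [a _|s' [us sM n_eq]] := @subset_sum_complete (codivisor M) M.+1 n _ n_le.
  exact: codivisor_complete.
by rewrite q_eq n_eq; apply: egyptian_of_codivisor_sum => // a /sM[].
Qed.

End ClosedUnderDoubling.

(** * The five sets: doubling and multiples *)

Lemma hardy_ramanujan_double n : hardy_ramanujan n -> hardy_ramanujan (2 * n).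
Proof.
move=> [n_gt0 n_logn]; split=> [|p r p_pr r_pr pr]; first by rewrite muln_gt0.
rewrite !lognM // leq_add ?n_logn // !(logn_prime _ (isT : prime 2)).
(* Only the exponent of 2 rises; if [r] is 2, then the prime [p <= r] is 2 as well. *)
have [r2|//] := eqVneq r 2.
by rewrite eqn_leq prime_gt1 // andbT -r2 pr.
Qed.

(** In Legendre's formula each term [n %/ p ^ k] is nonincreasing in [p]. Factorials supply the
    multiples of all positive integers. *)
Lemma hardy_ramanujan_fact n : hardy_ramanujan n`!.
Proof.
split=> [|p r p_pr r_pr pr]; first exact: fact_gt0.
rewrite !logn_fact //; apply: leq_sum => -[//|k] _.
by rewrite leq_div2l ?expn_gt0 ?prime_gt0 ?leq_exp2r.
Qed.

Lemma jordan_polya_gt0 n : jordan_polya n -> 0 < n.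
Proof. by move=> [s [_ ->]]; rewrite prodn_gt0 // => k; apply: fact_gt0. Qed.

Lemma jordan_polya_double n : jordan_polya n -> jordan_polya (2 * n).
Proof.
(* The new factor 2 is the factorial of 2. *)
move=> [s [s_gt0 ->]]; exists (2 :: s); split=> [k|]; last by rewrite big_cons.
by rewrite inE => /predU1P[->|/s_gt0].
Qed.

Lemma jordan_polya_fact n : 0 < n -> jordan_polya n`!.
Proof.
by move=> n_gt0; exists [:: n]; split=> [k|]; rewrite ?big_seq1 // inE => /eqP ->.
Qed.

Lemma two_part_dominant_double n : two_part_dominant n -> two_part_dominant (2 * n).
Proof.
move=> [k [l [l_odd l_le ->]]]; exists k.+1, l; split=> //.
  by rewrite (leq_trans l_le) // leq_exp2l.
by rewrite expnS mulnA.
Qed.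

(* The multiple is the sum of the [l] powers [4 ^ (totient l * j)], [j < l], each
   of which is 1 modulo [l] by Euler's theorem. *)
Lemma multiple_of_base4_closed (P : nat -> Prop) l :
  P 0 -> (forall n, P n -> P (4 * n)) -> (forall n, P n -> P (4 * n).+1) ->
  odd l -> exists2 m, 0 < m /\ P m & l %| m.
Proof.
move=> P0 P4 P41 l_odd.
have l_gt0 : 0 < l by case: l l_odd.
pose m r := \sum_(j < r) (4 ^ totient l) ^ j.
have t_gt0 : 0 < totient l by rewrite totient_gt0.
(* Horner form: in base 4, [m r] is followed by [totient l - 1] digits 0 and then a digit 1, which
   are the operations that preserve [P]. *)
have mS r : m r.+1 = (4 * (4 ^ (totient l).-1 * m r)).+1.
  rewrite /m big_ord_recl expn0 add1n mulnA -expnS prednK // big_distrr /=.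
  by congr _.+1; apply: eq_bigr => j _; rewrite expnS.
have P4X k n : P n -> P (4 ^ k * n).
  by move=> Pn; elim: k => [|k IHk]; rewrite ?mul1n // expnS -mulnA; apply: P4.
have Pm r : P (m r).
  by elim: r => [|r IHr]; [rewrite /m big_ord0|rewrite mS; apply/P41/P4X].
exists (m l); first by split=> //; rewrite -(prednK l_gt0) mS.
have mE r : m r = r %[mod l].
  elim: r => [|r IHr]; first by rewrite /m big_ord0.
  rewrite mS mulnA -expnS prednK // -addn1 -modnDml -modnMm IHr.
  rewrite Euler_exp_totient ?coprimeXl ?coprime2n //; last first.
    by rewrite (@coprimeXl 2 2) // coprime2n.
  by rewrite modnMm mul1n modnDml addn1.
by rewrite /dvdn mE modnn.
Qed.

Lemma sum_distinct_pow4_0 : sum_distinct_pow4 0.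
Proof. by exists fset0; rewrite big_seq_fset0. Qed.

Lemma sum_distinct_pow4_succ (A : {fset nat}) :
  \sum_(i <- [fset i.+1 | i in A]%fset) 4 ^ i = 4 * \sum_(i <- A) 4 ^ i.
Proof.
rewrite big_imfset /=; last by move=> i j _ _ [].
by rewrite big_distrr; apply: eq_bigr => i _; rewrite expnS.
Qed.

Lemma sum_distinct_pow4_mul4 n : sum_distinct_pow4 n -> sum_distinct_pow4 (4 * n).
Proof.
by move=> [A ->]; exists [fset i.+1 | i in A]%fset; rewrite sum_distinct_pow4_succ.
Qed.

Lemma sum_distinct_pow4_mul4S n :
  sum_distinct_pow4 n -> sum_distinct_pow4 (4 * n).+1.
Proof.
move=> [A ->]; exists (0 |` [fset i.+1 | i in A])%fset.
rewrite big_fsetU1 /= ?sum_distinct_pow4_succ ?add1n //.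
by apply/negP => /imfsetP[].
Qed.

(** Doubling exchanges the two forms: twice a doubled sum is four times a sum, which only shifts the
    exponents. *)
Lemma pow4_sum_or_double_double n :
  pow4_sum_or_double n -> pow4_sum_or_double (2 * n).
Proof.
move=> [n_gt0 n_pow4]; split; first by rewrite muln_gt0.
case: n_pow4 => [n_pow4|[m [m_pow4 ->]]]; first by right; exists n.
by left; rewrite mulnA; apply: sum_distinct_pow4_mul4.
Qed.

Lemma div2_double n : Nat.div2 (2 * n) = n.
Proof. by elim: n => // n IHn; rewrite mulnS /= IHn. Qed.

Lemma div2_doubleS n : Nat.div2 (2 * n).+1 = n.
Proof. by elim: n => // n IHn; rewrite mulnS; exact: (congr1 S IHn). Qed.

Lemma testbit0_double n : Nat.testbit (2 * n) 0 = false.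
Proof. by elim: n => // n IHn; rewrite mulnS. Qed.

Lemma testbitS n i : Nat.testbit n i.+1 = Nat.testbit (Nat.div2 n) i.
Proof. by []. Qed.

Lemma fibbinary0 : fibbinary 0.
Proof. by elim. Qed.

Lemma fibbinary_double n : fibbinary n -> fibbinary (2 * n).
Proof.
move=> n_fib [|i]; first by rewrite testbit0_double.
by rewrite !testbitS div2_double; apply: n_fib.
Qed.

(** In binary this appends the digits 01, and the 0 separates the new 1 from the digits of [n]. *)
Lemma fibbinary_mul4S n : fibbinary n -> fibbinary (4 * n).+1.
Proof.
move=> n_fib i; rewrite -(mulnA 2 2).
case: i => [|i]; rewrite !testbitS div2_doubleS.
  by rewrite testbit0_double andbF.
exact: fibbinary_double.
Qed.

Theorem corollary2 (R : realType) (S : set nat)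
  (hS : S = hardy_ramanujan \/ S = jordan_polya \/ S = positive_fibbinary \/
        S = pow4_sum_or_double \/ S = two_part_dominant)
  (q : rat) (q_gt0 : (0 < q)%R)
  (q_lt : ((ratr q : R)%:E < (\esum_(s in S) ((s%:R : R)^-1)%:E)%R)%E) :
  exists D : {fset nat},
    (forall d : nat, d \in D -> S d) /\ (q = \sum_(d <- D) (d%:R)^-1)%R.
Proof.
have [S_gt0 S_double S_dvd] : [/\ forall n, S n -> 0 < n,
    forall n, S n -> S (2 * n) & forall n, 0 < n -> exists2 s, S s & n %| s].
  case: hS => [->|[->|[->|[->|->]]]].
  - split=> [n []//|n|n n_gt0]; first exact: hardy_ramanujan_double.
    by exists n`!; [apply: hardy_ramanujan_fact|rewrite dvdn_fact // n_gt0 /=].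
  - split=> [n|n|n n_gt0]; [exact: jordan_polya_gt0|exact: jordan_polya_double|].
    by exists n`!; [apply: jordan_polya_fact|rewrite dvdn_fact // n_gt0 /=].
  - have fib_gt0 n : positive_fibbinary n -> 0 < n by case.
    have fib_double n : positive_fibbinary n -> positive_fibbinary (2 * n).
      by move=> [n_gt0 /fibbinary_double]; split; rewrite ?muln_gt0.
    split=> //; apply: multiple_of_odd_multiple => // l l_odd.
    have fib_mul4 n : fibbinary n -> fibbinary (4 * n).
      by move=> n_fib; rewrite -(mulnA 2 2); do 2!apply: fibbinary_double.
    exact: (multiple_of_base4_closed fibbinary0 fib_mul4 fibbinary_mul4S).
  - have pow4_gt0 n : pow4_sum_or_double n -> 0 < n by case.
    split=> //; first exact: pow4_sum_or_double_double.
    apply: multiple_of_odd_multiple => [|l l_odd].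
      exact: pow4_sum_or_double_double.
    have [m [m_gt0 m_pow4] lm] := multiple_of_base4_closed sum_distinct_pow4_0
      sum_distinct_pow4_mul4 sum_distinct_pow4_mul4S l_odd.
    by exists m => //; split; [|left].
  - split=> [n [k [l [/odd_gt0 l_gt0 _ ->]]]||].
    + by rewrite muln_gt0 expn_gt0.
    + exact: two_part_dominant_double.
    + apply: multiple_of_odd_multiple => [|l l_odd].
        exact: two_part_dominant_double.
      (* The exponent [l] is large enough, as [l < 2 ^ l]. *)
      exists (2 ^ l * l); last exact: dvdn_mull.
      by exists l, l; split; rewrite // ltnW // ltn_expl.
(* The possibly infinite sum is a supremum over finite subsets of [S], so the strict inequality
   already holds for some finite [A]. *)
have [_ [A [A_fin A_S] <-] q_lt_A] := ereal_sup_gt q_lt.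
rewrite fsbig_finite //= sumEFin lte_fin in q_lt_A.
apply: (egyptian_of_doubling S_gt0 S_double (F := fset_set A)) => //.
  by move=> f; rewrite in_fset_set // inE => /A_S.
rewrite -(ler_rat R) rmorph_sum /= ltW // (lt_le_trans q_lt_A) //.
by apply: ler_sum => f _; rewrite fmorphV rmorph_nat.
Qed.
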